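(* Let $H$ be a fixed graph. Then there exists $k_H\in[0,1)$ such that for every $c\in[0,1]$ with $c>k_H$, $\mathcal{M}_H(c)$ is achieved on the quasi-clique, i.e. $$\mathcal{M}_H(c)=\limsup_{G\in\mathcal{C}_c\cap\mathcal{Q}}t(H,G),$$ where $\mathcal{Q}$ is the set of quasi-cliques.
   Context: Graphs are finite and simple; $|G|$ is the number of vertices of $G$. $\hom(H,G)$ is the number of homomorphisms (edge-preserving vertex maps) from $H$ to $G$ and $t(H,G)=\hom(H,G)/|G|^{|H|}$. $\mathcal{C}_c=\{G:t(K_2,G)\le c\}$. For a class $\mathcal{C}$ of graphs, $\limsup_{G\in\mathcal{C}}f(G)=\lim_{n\to\infty}\sup\{f(G):G\in\mathcal{C},|G|\ge n\}$, and $\mathcal{M}_H(c)=\limsup_{G\in\mathcal{C}_c}t(H,G)$. A quasi-clique is a graph consisting of a clique together with isolated vertices (either part may be empty). *)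

(* Defs.v *)
From HB Require Import structures.
From mathcomp Require Import all_boot all_order all_algebra.
From mathcomp Require Import all_classical all_reals all_analysis.

Set Implicit Arguments.
Unset Strict Implicit.
Unset Printing Implicit Defensive.

Import Order.TTheory GRing.Theory Num.Theory.
Import numFieldNormedType.Exports.

Local Open Scope classical_set_scope.
Local Open Scope ring_scope.

Record sgraph := SGraph {
  vertex :> finType;
  adj : rel vertex;
  adj_sym : symmetric adj;
  adj_irr : irreflexive adj }.

Definition is_hom (H G : sgraph) (f : {ffun H -> G}) : bool :=
  [forall x, forall y, adj x y ==> adj (f x) (f y)].

Definition hom (H G : sgraph) : nat := #|[set f : {ffun H -> G} | is_hom f]%SET|.

Definition hom_density (R : realType) (H G : sgraph) : R :=
  (hom H G)%:R / #|G|%:R ^+ #|H|.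

Definition K2_adj : rel 'I_2 := fun x y => x != y.

Lemma K2_adj_sym : symmetric K2_adj.
Proof. by move=> x y; rewrite /K2_adj eq_sym. Qed.

Lemma K2_adj_irr : irreflexive K2_adj.
Proof. by move=> x; rewrite /K2_adj eqxx. Qed.

Definition K2 : sgraph := SGraph K2_adj_sym K2_adj_irr.

(* Classes of graphs are bare predicates: the universe of classical [set] lies
   strictly below that of [finType], so [set sgraph] is not typable. *)
Definition graph_class := sgraph -> Prop.

Definition graph_classI (C D : graph_class) : graph_class :=
  fun G => C G /\ D G.

Definition density_le (R : realType) (c : R) : graph_class :=
  fun G => hom_density R K2 G <= c.

Definition quasi_clique : graph_class :=
  fun G => exists K : {set G},
    forall x y : G, adj x y = [&& x != y, x \in K & y \in K].

(* Taken in the extended reals, where every supremum exists (-oo for the empty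
   set) and the nonincreasing sequence of suprema always converges. *)
Definition graph_limsup (R : realType) (C : graph_class) (f : sgraph -> R) :
    \bar R :=
  limn (fun n : nat => ereal_sup
    [set y : \bar R | exists G : sgraph, [/\ C G, (n <= #|G|)%N & y = (f G)%:E]]).

Definition max_density (R : realType) (H : sgraph) (c : R) : \bar R :=
  graph_limsup (density_le c) (hom_density R H).

(* Main.v *)
(* Let b = sqrt c and let m be the number of non-isolated vertices of H. For c
   close to 1 both sides equal b ^ m.
   Upper bound: H has a spanning forest of stars covering its non-isolated
   vertices, so t(H, G) is at most a product of star densities, that is, of
   moments E[d ^ s] of the normalised degree d. It remains to show that
   E[d ^ s] <= (E d) ^ ((s + 1) / 2) when E d is close to 1. Let A be the set of
   vertices with d <= 1 - delta and a its relative size, so that the quasi-clique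
   on the complement of A has density (1 - a) ^ 2. On A bound d ^ s by
   (1 - delta) ^ (s - 1) * d, and off A expand d ^ s to second order around
   1 - a; comparing with the tangent of c |-> c ^ ((s + 1) / 2) at (1 - a) ^ 2,
   every deviation from the quasi-clique enters with a favourable sign as soon as
   a << delta << 1 / s.
   Lower bound: cliques on about b * n of n vertices. *)
Require Import Defs.
From HB Require Import structures.
From mathcomp Require Import all_boot all_order all_algebra.
From mathcomp Require Import all_classical all_reals all_analysis.
From mathcomp Require Import ring lra.

Set Implicit Arguments.
Unset Strict Implicit.
Unset Printing Implicit Defensive.

Import Order.TTheory GRing.Theory Num.Theory.
Import numFieldNormedType.Exports.

Local Open Scope classical_set_scope.
Local Open Scope ring_scope.

(** * Polynomial inequalities for powers *)

Section RealInequalities.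
Variable R : realFieldType.
Implicit Types x y : R.

(** Induction on [s] after multiplying by [y]: by Pascal's rule the two sides then differ by
    ['C(s.+1, 2) * (1 - y) * (y - x) ^+ 2] plus [s.+1 * (1 - x ^+ s) * (y - x) ^+ 2], both
    nonnegative. *)
Lemma expr_taylor2_le (s : nat) x y : 0 <= x <= 1 -> 0 <= y <= 1 ->
  y ^+ s.+1 <= x ^+ s.+1 + s.+1%:R * x ^+ s * (y - x)
               + 'C(s.+1, 2)%:R * (y - x) ^+ 2.
Proof.
move=> /andP[x0 x1] /andP[y0 y1]; elim: s => [|s IHs].
  by rewrite !expr1 expr0 mul0r addr0; lra.
have sq0 := sqr_ge0 (y - x).
have yle : y * ('C(s.+1, 2)%:R * (y - x) ^+ 2) <= 'C(s.+1, 2)%:R * (y - x) ^+ 2.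
  by rewrite ler_piMl// mulr_ge0.
have xle : s.+1%:R * x ^+ s * (y - x) ^+ 2 <= s.+1%:R * (y - x) ^+ 2.
  by rewrite ler_wpM2r// ler_piMr// exprn_ile1.
rewrite exprS (le_trans (ler_wpM2l y0 IHs))//.
rewrite (binS s.+1) bin1 natrD -(natr1 s.+1) !(exprS x s.+1) !(exprS x s).
move: yle xle; move: (x ^+ s) ('C(s.+1, 2)%:R) (s.+1%:R) => X C S yle xle.
rewrite -subr_ge0; move: yle xle; rewrite -subr_ge0 => yle.
rewrite -subr_ge0 => xle.
by have := addr_ge0 yle xle; congr (0 <= _); ring.
Qed.

(** Convexity of c |-> c ^ ((s + 2) / 2): the tangent at x ^ 2 is evaluated at y ^ 2, so that no
    fractional power occurs. *)
Lemma expr_tangent_sqr_le (s : nat) x y : 0 <= x -> 0 <= y ->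
  x ^+ s.+2 + s.+2%:R / 2 * x ^+ s * (y ^+ 2 - x ^+ 2) <= y ^+ s.+2.
Proof.
move=> x0 y0; elim: s => [|s IHs].
  by rewrite expr0 divff// mulr1 mul1r; lra.
rewrite [y ^+ _]exprS (le_trans _ (ler_wpM2l y0 IHs))//.
rewrite -(natr1 s.+2) !(exprS x s.+2) !(exprS x s.+1) !(exprS x s).
have X0 : 0 <= x ^+ s by rewrite exprn_ge0.
have S1 : 1 <= s.+2%:R :> R by rewrite ler1n.
move: X0 S1; move: (x ^+ s) (s.+2%:R) => X S X0 S1.
have h1 : 0 <= X * (y - x) ^+ 2 * ((S - 1) * x + S * y).
  apply: mulr_ge0; first by rewrite mulr_ge0 ?sqr_ge0.
  by apply: addr_ge0; apply: mulr_ge0 => //; lra.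
rewrite -subr_ge0.
have -> : y * (x * (x * X) + S / 2 * X * (y ^+ 2 - x ^+ 2)) -
  (x * (x * (x * X)) + (S + 1) / 2 * (x * X) * (y ^+ 2 - x ^+ 2)) =
   (X * (y - x) ^+ 2 * ((S - 1) * x + S * y)) / 2 by field.
lra.
Qed.

Lemma bernoulli_le (n : nat) x : 0 <= x <= 1 -> 1 - n%:R * x <= (1 - x) ^+ n.
Proof.
move=> /andP[x0 x1]; elim: n => [|n IHn]; first by rewrite expr0; lra.
have x1' : 0 <= 1 - x by lra.
rewrite exprS (le_trans _ (ler_wpM2l x1' IHn))// -natr1.
have : 0 <= n%:R * x ^+ 2 by rewrite mulr_ge0 ?sqr_ge0.
nra.
Qed.

Lemma ler_sub_exprn (n : nat) x y : 0 <= y <= x -> x <= 1 ->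
  x ^+ n - y ^+ n <= n%:R * (x - y).
Proof.
move=> /andP[y0 yx] x1; elim: n => [|n IHn].
  by rewrite !expr0 subrr mul0r.
have -> : x ^+ n.+1 - y ^+ n.+1 = x * (x ^+ n - y ^+ n) + (x - y) * y ^+ n.
  by rewrite !exprS; ring.
rewrite -natr1 [leRHS]mulrDl mul1r lerD//.
  rewrite (le_trans _ IHn)// ler_piMl// subr_ge0 lerXn2r ?nnegrE//.
  exact: le_trans yx.
rewrite ler_piMr// ?subr_ge0// exprn_ile1//; exact: le_trans x1.
Qed.

End RealInequalities.

(** * Averages over a finite set *)

Section Average.
Variables (R : realFieldType) (T : finType).
Implicit Types f g : T -> R.

Definition avg f : R := (\sum_x f x) / #|T|%:R.

Lemma eq_avg f g : f =1 g -> avg f = avg g.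
Proof. by move=> fg; rewrite /avg (eq_bigr _ (fun x _ => fg x)). Qed.

Lemma avgD f g : avg (fun x => f x + g x) = avg f + avg g.
Proof. by rewrite /avg big_split mulrDl. Qed.

Lemma avgZ k f : avg (fun x => k * f x) = k * avg f.
Proof. by rewrite /avg -mulr_sumr mulrA. Qed.

Lemma avgZr k f : avg (fun x => f x * k) = avg f * k.
Proof. by rewrite /avg -mulr_suml mulrAC. Qed.

Lemma avgB f g : avg (fun x => f x - g x) = avg f - avg g.
Proof. by rewrite /avg sumrB mulrBl. Qed.

Lemma le_avg f g : (forall x, f x <= g x) -> avg f <= avg g.
Proof. by move=> fg; rewrite ler_wpM2r ?invr_ge0// ler_sum. Qed.

Lemma avg_ge0 f : (forall x, 0 <= f x) -> 0 <= avg f.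
Proof. by move=> f0; rewrite mulr_ge0 ?invr_ge0// sumr_ge0. Qed.

Lemma avg_cst k : (0 < #|T|)%N -> avg (fun=> k) = k.
Proof.
by move=> T0; rewrite /avg sumr_const -[k *+ _]mulr_natr mulfK// pnatr_eq0 -lt0n.
Qed.

Lemma exchange_avg (F : T -> T -> R) :
  avg (fun x => avg (F x)) = avg (fun y => avg (F^~ y)).
Proof. by rewrite /avg -!mulr_suml exchange_big. Qed.

End Average.

(** Coefficient comparison for [star_moment_le_near_clique]: z = S, d = 1 / (2 z), m + 1 is the
    exponent of the moment, a the relative size of [A], and B = (1 - a) ^ m. *)
Lemma near_clique_arith (R : realFieldType) (z a d m K q B : R) :
  0 <= a -> d * (2 * z) = 1 -> a * (2 * z ^+ 3) <= 1 -> 1 <= m -> m + 1 <= z ->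
  K * 2 = (m + 1) * m -> 1 - m * a <= B -> q <= 1 - d ->
  [/\ 1 <= 2 * B, q + K * a <= B & K * d <= m / 2 * B].
Proof.
move=> a0 dz az m1 mz KE Bge qle.
have z2 : 2 <= z by lra.
have z_gt0 : 0 < 2 * z by lra.
have za : z ^+ 2 * a <= d.
  by rewrite -(ler_pM2r z_gt0) dz (le_trans _ az)// le_eqVlt; apply/orP; left;
     apply/eqP; ring.
have d4 : d * 4 <= 1.
  rewrite -dz ler_wpM2l//; last by lra.
  by rewrite -(ler_pM2r z_gt0) mul0r dz ler01.
have ma : m * a <= (z - 1) * a by rewrite ler_wpM2r//; lra.
have Ka : K * 2 * a <= z * (z - 1) * a.
  by rewrite ler_wpM2r// KE ler_pM//; lra.
have z2a : (z ^+ 2 + z - 2) * a <= (2 * z ^+ 2) * a.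
  rewrite ler_wpM2r//; have := sqr_ge0 (z - 1); have := sqr_ge0 z; lra.
have ma1 : m * a <= z ^+ 2 * a.
  by rewrite ler_wpM2r// expr2 (@le_trans _ _ z)//; [lra|rewrite ler_peMr//; lra].
split; [lra|lra|].
have d0 : 0 <= d by rewrite -(ler_pM2r z_gt0) mul0r dz ler01.
have h1 : (m + 1) * m * d <= z * m * d.
  by rewrite ler_wpM2r// ler_wpM2r//; lra.
have h2 : m * 1 <= m * (2 * B) by rewrite ler_wpM2l//; lra.
have h3 : z * m * d * 2 = m.
  by rewrite -[RHS]mulr1 -[in RHS]dz; ring.
have h4 : K * 2 * d = (m + 1) * m * d by rewrite KE.
lra.
Qed.

(** * Degree moments near a quasi-clique *)

Section StarMoments.
Variables (R : realFieldType) (T : finType) (W : T -> T -> R).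
Hypothesis T_gt0 : (0 < #|T|)%N.
Hypothesis W01 : forall x y, 0 <= W x y <= 1.
Hypothesis W_sym : forall x y, W x y = W y x.

Definition wdeg (x : T) : R := avg (W x).

Lemma wdeg01 x : 0 <= wdeg x <= 1.
Proof.
apply/andP; split; first by apply: avg_ge0 => y; case/andP: (W01 x y).
by rewrite -(avg_cst 1 T_gt0); apply: le_avg => y; case/andP: (W01 x y).
Qed.

Section Split.
Variable A : {pred T}.
Let chi (x : T) : R := (x \in A)%:R.

Definition size_in : R := avg chi.
Definition deg_in (x : T) : R := avg (fun y => chi y * W x y).
(** The prefix [co] refers to the complement [1 - W]. *)
Definition codeg_out (x : T) : R := avg (fun y => (1 - chi y) * (1 - W x y)).

Let chi01 x : 0 <= chi x <= 1.
Proof. by rewrite /chi; case: (x \in A); rewrite ?lexx ler01. Qed.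

Lemma size_in01 : 0 <= size_in <= 1.
Proof.
apply/andP; split; first by apply: avg_ge0 => y; case/andP: (chi01 y).
by rewrite -(avg_cst 1 T_gt0); apply: le_avg => y; case/andP: (chi01 y).
Qed.

Lemma deg_in_ge0 x : 0 <= deg_in x.
Proof.
apply: avg_ge0 => y; case/andP: (chi01 y) => c0 c1; case/andP: (W01 x y) => w0 w1.
exact: mulr_ge0.
Qed.

Lemma deg_in_le x : deg_in x <= size_in.
Proof.
apply: le_avg => y; case/andP: (chi01 y) => c0 c1; case/andP: (W01 x y) => w0 w1.
by rewrite ler_piMr.
Qed.

Lemma codeg_out_ge0 x : 0 <= codeg_out x.
Proof.
apply: avg_ge0 => y; case/andP: (chi01 y) => c0 c1; case/andP: (W01 x y) => w0 w1.
by rewrite mulr_ge0 ?subr_ge0.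
Qed.

Lemma wdeg_split x : wdeg x = (1 - size_in) + deg_in x - codeg_out x.
Proof.
rewrite /size_in -{1}(avg_cst 1 T_gt0) -avgB -avgD -avgB.
by apply: eq_avg => y; ring.
Qed.

Definition mass_in := avg (fun x => chi x * deg_in x).
Definition mass_cross := avg (fun x => (1 - chi x) * deg_in x).
Definition comass_out := avg (fun x => (1 - chi x) * codeg_out x).

(** By symmetry of [W], the mass between [A] and its complement may be counted from either side. *)
Lemma avg_wdeg_in : avg (fun x => chi x * wdeg x) = mass_in + mass_cross.
Proof.
rewrite -avgD [RHS](eq_avg (g := deg_in)) => [|x]; last by ring.
rewrite /deg_in exchange_avg; apply: eq_avg => x.
by rewrite -avgZ; apply: eq_avg => y; rewrite W_sym.
Qed.

Lemma avg_wdeg_split :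
  avg wdeg = (1 - size_in) ^+ 2 + mass_in + 2 * mass_cross - comass_out.
Proof.
rewrite (eq_avg (g := fun x => chi x * wdeg x + ((1 - size_in) * (1 - chi x) +
   ((1 - chi x) * deg_in x - (1 - chi x) * codeg_out x)))) => [|x]; last first.
  by rewrite wdeg_split; ring.
rewrite avgD avgD avgZ !avgB avg_cst// avg_wdeg_in.
by rewrite -/size_in -/mass_cross -/comass_out; ring.
Qed.

End Split.
Arguments size_in : clear implicits.

(** A pointwise bound on the power of the degree, once averaged, and the tangent to the right-hand
    side are both affine in the three deviations from the quasi-clique; their coefficients are
    compared. *)
Lemma star_moment_le_near_clique (s S : nat) (y : R) : (0 < s)%N -> (s <= S)%N ->
  0 <= y -> avg wdeg = y ^+ 2 -> 1 - (4 * S%:R ^+ 4)^-1 <= avg wdeg ->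
  avg (fun x => wdeg x ^+ s) <= y ^+ s.+1.
Proof.
(* For exponent 1 both sides are the edge density; from here on the exponent is [s.+2]. *)
case: s => // -[_ _ _ Ey _|s _ sS y0 Ey Hc].
  by rewrite -Ey; apply: le_avg => x; rewrite expr1.
pose z : R := S%:R.
have z2 : 2 <= z by rewrite ler_nat (leq_trans _ sS).
have z0 : z != 0 by apply/eqP; lra.
(* With m = [s.+1], K = (m + 1) m / 2 and m + 1 <= z, this choice gives K delta <= m / 4, as the
   coefficient of [rho] requires. *)
pose delta : R := (2 * z)^-1.
have d0 : 0 < delta by rewrite invr_gt0; lra.
have dz : delta * (2 * z) = 1 by rewrite mulVf// mulf_neq0// pnatr_eq0.
have d1 : delta <= 1 by rewrite invf_le1; lra.
(* [mass_in], [mass_cross] and [comass_out] vanish when W is the clique on the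
   complement of A, and measure how far W is from it. *)
pose A := [pred x | delta <= 1 - wdeg x].
have [a0 a1] := andP (size_in01 A).
(* Markov's inequality for [1 - wdeg x]; with the density hypothesis it makes [A] of size at most 1
   / (2 z ^ 3). *)
have aE : size_in A * delta <= 1 - avg wdeg.
  rewrite /size_in -avgZr -{2}(avg_cst 1 T_gt0) -avgB; apply: le_avg => x.
  rewrite /= inE /=; case: (lerP delta (1 - wdeg x)) => h /=; rewrite ?mul1r// mul0r subr_ge0.
  by case/andP: (wdeg01 x).
have az : size_in A * (2 * z ^+ 3) <= 1.
  have : size_in A * delta * (4 * z ^+ 4) <= 1.
    rewrite -[leRHS](@mulVf _ (4 * z ^+ 4)); last first.
      by rewrite mulf_neq0 ?pnatr_eq0// expf_neq0.
    by rewrite ler_wpM2r ?mulr_ge0 ?exprn_ge0 ?ler0n//; lra.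
  by congr (_ <= _); rewrite -[RHS]mulr1 -dz; ring.
set a := size_in A in a0 a1 aE az *.
set b : R := 1 - a.
have b01 : 0 <= b <= 1 by rewrite /b; apply/andP; split; lra.
have sz : s.+2%:R <= z by rewrite ler_nat.
have := avg_wdeg_split A; rewrite -/a -/b.
set P := mass_in A; set Q := mass_cross A; set rho := comass_out A => EW.
pose K : R := 'C(s.+2, 2)%:R.
pose q : R := (1 - delta) ^+ s.+1.
have chiE x : ((x \in A)%:R : R) = (nat_of_bool (delta <= 1 - wdeg x)%R)%:R by rewrite inE.
(* On [A] one factor [wdeg x] is kept and the others are at most [1 - delta]; off [A] the power is
   expanded to second order around [b]. *)
have pt x : wdeg x ^+ s.+2 <= q * ((x \in A)%:R * wdeg x) + (
    (b ^+ s.+2) * (1 - (x \in A)%:R)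
    + ((s.+2%:R * b ^+ s.+1 + K * a) * ((1 - (x \in A)%:R) * deg_in A x)
    + (K * delta - s.+2%:R * b ^+ s.+1) * ((1 - (x \in A)%:R) * codeg_out A x))).
  have [w0 w1] := andP (wdeg01 x).
  have e0 := deg_in_ge0 A x; have e1 := deg_in_le A x.
  have r0 := codeg_out_ge0 A x.
  have wE := wdeg_split A x; rewrite -/a -/b in wE e1.
  rewrite chiE; case: (lerP delta (1 - wdeg x)) => h /=.
    rewrite subrr !mul0r !mulr0 !addr0 mul1r exprSr ler_wpM2r//.
    by rewrite lerXn2r// ?nnegrE; lra.
  rewrite mul0r mulr0 add0r subr0 !mulr1 !mul1r.
  rewrite (le_trans (expr_taylor2_le s.+1 b01 (wdeg01 x)))// -/K.
  have K0 : 0 <= K by rewrite ler0n.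
  have wb : wdeg x - b = deg_in A x - codeg_out A x by rewrite wE; ring.
  (* Off [A], [deg_in] lies in [0, a] and [codeg_out] in [0, delta], so the square of their
     difference has a linear bound. *)
  have : (wdeg x - b) ^+ 2 <= a * deg_in A x + delta * codeg_out A x.
    have : codeg_out A x <= delta by rewrite /b in wE; lra.
    rewrite wb => rd.
    have := mulr_ge0 e0 r0.
    have : 0 <= (delta - codeg_out A x) * codeg_out A x.
      by rewrite mulr_ge0 ?subr_ge0.
    have : 0 <= (a - deg_in A x) * deg_in A x by rewrite mulr_ge0 ?subr_ge0.
    lra.
  move=> /(ler_wpM2l K0); rewrite wb; move: (b ^+ _) (b ^+ _) => X Y.
  lra.
rewrite (le_trans (le_avg pt))// !avgD !avgZ avgB avg_cst//.
rewrite -/(size_in A) -/(mass_cross A) -/(comass_out A) avg_wdeg_in.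
rewrite -/P -/Q -/rho -/a -/b.
have P0 : 0 <= P.
  by apply: avg_ge0 => x; rewrite mulr_ge0 ?ler0n ?deg_in_ge0.
have Q0 : 0 <= Q.
  by apply: avg_ge0 => x; rewrite mulr_ge0 ?deg_in_ge0// subr_ge0 lern1 leq_b1.
have rho0 : 0 <= rho.
  by apply: avg_ge0 => x; rewrite mulr_ge0 ?codeg_out_ge0// subr_ge0 lern1 leq_b1.
(* The tangent at [b] shares the term b ^ (s + 3) with the averaged bound; only the coefficients of
   [P], [Q] and [rho] remain to be compared. *)
have := expr_tangent_sqr_le s.+1 (proj1 (andP b01)) y0.
apply: le_trans; rewrite -Ey EW.
have KE : K * 2 = s.+2%:R * s.+1%:R.
  by rewrite /K -natrM mulnC -(mul_bin_diag s.+2 1) bin1 natrM.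
have Bge : 1 - s.+1%:R * a <= b ^+ s.+1 by rewrite bernoulli_le// a0.
have qle : q <= 1 - delta.
  by rewrite /q exprS ler_piMr ?subr_ge0// exprn_ile1 ?subr_ge0//; lra.
rewrite -!exprSr !(exprS b s.+2) !(exprS b s.+1).
move: sz KE Bge; rewrite -(natr1 s.+2) -(natr1 s.+1).
have : 1 <= s.+1%:R :> R by rewrite ler1n.
move: (b ^+ s.+1) (s.+1%:R) => B m m1 sz KE Bge.
have [B2 f2 f3] := near_clique_arith a0 dz az m1 sz KE Bge qle.
have K0 : 0 <= K by rewrite ler0n.
have f4 : q * P <= B * P.
  by rewrite ler_wpM2r// (le_trans _ f2)// lerDl mulr_ge0.
have f5 : (q + K * a) * Q <= B * Q by rewrite ler_wpM2r.
have f6 : K * delta * rho <= m / 2 * B * rho by rewrite ler_wpM2r.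
have f7 : 0 <= m / 2 * B * P.
  by rewrite mulr_ge0// mulr_ge0//; lra.
clearbody K q P Q rho b delta a; clear -f4 f5 f6 f7.
lra.
Qed.

End StarMoments.

(** * Spanning star forests *)

Section StarForest.
Variable H : sgraph.
Implicit Types (x y v w : H) (p : {ffun H -> H}).

Definition isolated_vertex x := [forall y, ~~ adj x y].

(* A star forest is encoded by the map sending each vertex to the center of its
   star; the fixed points are the centers. *)
Definition star_map p :=
  [forall x, (p (p x) == p x) && ((p x == x) || adj (p x) x)].

Definition nontrivial_star p x := [exists y, (p y != y) && (p y == p x)].

Definition uncovered p := [set x | ~~ isolated_vertex x & ~~ nontrivial_star p x]%SET.

(** An uncovered [v] is a star by itself and has a neighbour [w]; a star centered at [w] can absorb
    [v] without uncovering any vertex. *)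
Lemma star_map_improve p v : star_map p -> v \in uncovered p ->
  exists2 p', star_map p' & uncovered p' \proper uncovered p.
Proof.
move=> /forallP sp; rewrite inE negb_forall => /andP[/existsP[w]].
rewrite negbK => vw /existsPn vtriv.
have pp x : p (p x) = p x by case/andP: (sp x) => /eqP.
have padj x : p x != x -> adj (p x) x by case/andP: (sp x) => _ /orP[->|].
have triv y : p y = v -> y = v.
  move=> pyv; move: (vtriv y); have pv : p v = v by rewrite -pyv pp.
  by rewrite pv pyv eqxx andbT negbK => /eqP.
have pv : p v = v.
  by apply/eqP; move: (vtriv v); rewrite eqxx andbT negbK.
have nv z : z != v -> p z != v by apply: contraNneq => /triv ->.
have wv : w != v by apply: contraTneq vw => ->; rewrite adj_irr.
have adjwv : adj w v by rewrite adj_sym.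
(* The new forest is obtained by moving all of D into a star centered at w. *)
suff [D [Dv Dw Dadj Dfib cov]] : exists D : {set H},
    [/\ v \in D, w \in D, forall z, z \in D -> z != w -> adj w z,
        forall z, z \notin D -> p z \notin D &
        forall z, z \notin D -> nontrivial_star p z ->
          exists y, [/\ y \notin D, p y != y & p y = p z]].
  pose p' := [ffun z => if z \in D then w else p z].
  have p'E z : p' z = if z \in D then w else p z by rewrite ffunE.
  exists p'.
    apply/forallP => z; rewrite (p'E z); case: (boolP (z \in D)) => zD.
      rewrite p'E Dw eqxx eq_sym; case: eqVneq => //= zw; exact: Dadj.
    rewrite p'E (negbTE (Dfib _ zD)) pp eqxx.
    by case: (eqVneq (p z) z) => //= /padj.
  apply/properP; split; last first.
    exists v.
      rewrite inE negb_forall; apply/andP; split.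
        by apply/existsP; exists w; rewrite negbK.
      by apply/existsPn.
    rewrite inE negb_and; apply/orP; right; rewrite negbK.
    by apply/existsP; exists v; rewrite !ffunE Dv eqxx andbT.
  apply/fintype.subsetP => z; rewrite !inE => /andP[-> /=]; apply: contraNN => zcov.
  case: (boolP (z \in D)) => zD.
    by apply/existsP; exists v; rewrite !ffunE Dv zD eqxx andbT.
  have [y [yD yy yz]] := cov z zD zcov.
  by apply/existsP; exists y; rewrite !ffunE (negbTE yD) (negbTE zD) yy yz eqxx.
(* If [w] is a leaf whose star has another leaf [y0], cut [w] off and pair it with [v]; [y0] keeps
   the old star nontrivial. *)
case: (boolP [exists y, [&& p w != w, y != w, p y != y & p y == p w]]).
  move=> /existsP[y0 /and4P[pw y0w y0y0 /eqP y0p]].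
  exists (v |: [set w])%SET; split=> [|||z|z].
  - by rewrite !inE eqxx.
  - by rewrite !inE eqxx orbT.
  - by move=> z; rewrite !inE => /orP[|] /eqP-> //; rewrite eqxx.
  - rewrite !inE !negb_or => /andP[zv zw]; rewrite nv//=.
    by apply: contraNneq pw => <-; rewrite pp.
  rewrite !inE !negb_or => /andP[zv zw] /existsP[y /andP[yy /eqP yz]].
  have yv : y != v by apply: contraNneq yy => ->; rewrite pv.
  case: (eqVneq y w) => yw; last by exists y; rewrite !inE negb_or yv yw.
  exists y0; rewrite !inE negb_or y0w y0y0 y0p -yz yw; split=> //.
  by rewrite andbT; apply: contraNneq y0y0 => ->; rewrite pv.
(* Otherwise [w] is a center or its star is a single edge, so this star can be centered at [w], and
   [v] joins it. *)
move=> /existsPn alone.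
exists (v |: [set z | p z == p w])%SET; split=> [|||z|z].
- by rewrite !inE eqxx.
- by rewrite !inE eqxx orbT.
- move=> z; rewrite !inE => /orP[/eqP-> //|/eqP zw] zNw.
  move: (alone z); rewrite zw eqxx andbT zNw /= negb_and !negbK -zw.
  case/orP=> /eqP zE.
    by rewrite -{1}zE; apply: padj; rewrite zE eq_sym.
  by rewrite adj_sym -zE zw padj// -zw zE.
- rewrite !inE !negb_or => /andP[zv zw].
  by rewrite nv// pp.
rewrite !inE !negb_or => /andP[zv zw] /existsP[y /andP[yy /eqP yz]].
exists y; rewrite !inE negb_or yz zw; split=> //; last by rewrite -yz.
by rewrite andbT; apply: contraNneq yy => ->; rewrite pv.
Qed.

(** A star map with the fewest uncovered vertices has none, since it could be improved otherwise;
    the identity is a star map to start from. *)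
Lemma star_forest :
  exists2 p, star_map p & forall x, ~~ isolated_vertex x -> nontrivial_star p x.
Proof.
have id_star : star_map [ffun x => x].
  by apply/forallP => x; rewrite !ffunE eqxx.
have [p sp pmin] := arg_minnP (fun p => #|uncovered p|) id_star.
exists p => // x xiso; apply: contraT => xp.
have xu : x \in uncovered p by rewrite inE xiso.
have [p' sp' /proper_card] := star_map_improve sp xu.
by rewrite ltnNge pmin.
Qed.

End StarForest.

(** * Homomorphism densities bounded by star densities *)

Lemma natr_hom (R : pzRingType) (H G : sgraph) :
  (Defs.hom H G)%:R = \sum_(f : {ffun H -> G}) (is_hom f)%:R :> R.
Proof.
rewrite /Defs.hom -sum1_card natr_sum big_mkcond.
by apply: eq_bigr => f _; rewrite inE; case: (is_hom f).
Qed.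

Section StarForestBound.
Variables (R : realType) (H G : sgraph).
Implicit Types f g : {ffun H -> G}.

Definition adjr (x y : G) : R := (adj x y)%:R.

(** For a star map this vanishes off the centers, whose moments of order 0 then give trivial
    factors. *)
Definition leaves (p : {ffun H -> H}) (c : H) :=
  #|[pred x | (p x != x) && (p x == c)]|.

Lemma prod_leaves (p : {ffun H -> H}) (F : H -> R) :
  \prod_(x | p x != x) F (p x) = \prod_c F c ^+ leaves p c.
Proof.
rewrite (partition_big p predT)//=; apply: eq_bigr => c _.
by rewrite -prodr_const; apply: eq_bigr => x /andP[_ /eqP->].
Qed.

(** Forgetting the edges of [H] outside the forest only adds homomorphisms, and the density of a
    disjoint union of stars is the product of theirs. *)
Lemma hom_density_le_stars (p : {ffun H -> H}) : (0 < #|G|)%N -> star_map p ->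
  hom_density R H G <= \prod_(c : H) avg (fun v => wdeg adjr v ^+ leaves p c).
Proof.
move=> G0 /forallP sp.
pose n : R := #|G|%:R.
have n0 : n != 0 by rewrite pnatr_eq0 -lt0n.
have n_gt0 : 0 < n by rewrite ltr0n.
(* Constraint at [x] when its center goes to [v] and [x] to [w]: adjacency for a leaf, equality for
   a center. *)
pose T x v w : R := if p x != x then adjr v w else (v == w)%:R.
have T0 x v w : 0 <= T x v w by rewrite /T; case: ifP; rewrite ?ler0n.
(* g prescribes the centers and f the leaves; the values of g off the centers are
   free, which accounts for the factors n. *)
have glue f : (is_hom f)%:R * \prod_(x | p x != x) n
    <= \sum_(g : {ffun H -> G}) \prod_(x : H) T x (g (p x)) (f x).
  have -> : \prod_(x | p x != x) n =
      \prod_x \sum_(v : G) (if p x != x then 1 else (v == f x)%:R).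
    rewrite big_mkcond; apply: eq_bigr => x _; case: ifP => _.
      by rewrite sumr_const.
    by rewrite (bigD1 (f x))//= eqxx big1 ?addr0// => v /negbTE ->.
  rewrite bigA_distr_bigA mulr_sumr; apply: ler_sum => g _.
  case: (boolP (is_hom f)) => [/forallP fh|_]; last first.
    by rewrite mul0r prodr_ge0.
  rewrite mul1r; case: (boolP [forall x, (p x == x) ==> (g x == f x)]).
    move=> /forallP gf; apply: ler_prod => x _; rewrite /T.
    have /andP[/eqP ppx px] := sp x; case: (eqVneq (p x) x) px => /= [pxx _|_ px].
      by rewrite pxx; move: (gf x); rewrite pxx eqxx => /= ->; rewrite ler01 lexx.
    move: (gf (p x)); rewrite ppx eqxx => /= /eqP->.
    by have := forallP (fh (p x)) x; rewrite px /adjr => /= ->; rewrite ler01 lexx.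
  rewrite negb_forall => /existsP[x]; rewrite negb_imply => /andP[px gx].
  by rewrite (bigD1 x)//= px (negbTE gx) mul0r prodr_ge0.
(* For fixed [g], summing over [f] gives a degree for each leaf and 1 for each center; grouping the
   leaves by center then factors the sum over [g]. *)
have step2 : \sum_(f : {ffun H -> G}) \sum_(g : {ffun H -> G})
   \prod_(x : H) T x (g (p x)) (f x)
   = \prod_(c : H) \sum_(v : G) (n * wdeg adjr v) ^+ leaves p c.
  rewrite exchange_big bigA_distr_bigA; apply: eq_bigr => g _.
  rewrite -(bigA_distr_bigA (fun x => T x (g (p x)))).
  rewrite -(prod_leaves p (fun c => n * wdeg adjr (g c))) [RHS]big_mkcond.
  apply: eq_bigr => x _; rewrite /T; case: ifP => [_|_].
    by rewrite /wdeg /avg mulrCA divff// mulr1.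
  by rewrite (bigD1 (g (p x)))//= eqxx big1 ?addr0// => v;
     rewrite eq_sym => /negbTE ->.
have : (Defs.hom H G)%:R * \prod_(x | p x != x) n <=
    \prod_(c : H) \sum_(v : G) (n * wdeg adjr v) ^+ leaves p c.
  by rewrite natr_hom mulr_suml -step2; apply: ler_sum => f _; exact: glue.
rewrite (prod_leaves p (fun=> n)) => homle.
have -> : \prod_(c : H) avg (fun v => wdeg adjr v ^+ leaves p c) =
    (\prod_(c : H) \sum_(v : G) (n * wdeg adjr v) ^+ leaves p c)
    / (\prod_(c : H) n ^+ leaves p c) / n ^+ #|H|.
  rewrite -prodr_const -!prodf_div; apply: eq_bigr => c _.
  under [in RHS]eq_bigr do rewrite exprMn.
  rewrite -mulr_sumr.
  by rewrite [n ^+ _ * _]mulrC mulfK// expf_neq0.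
apply: ler_wpM2r; first by rewrite invr_ge0 exprn_ge0// ler0n.
rewrite ler_pdivlMr//; apply: prodr_gt0 => c _; exact: exprn_gt0.
Qed.

End StarForestBound.

(** * Upper bound on the density *)

Section UpperBound.
Variable R : realType.

(** The exponent of the limiting value. *)
Definition degree_support (H : sgraph) := #|[pred x : H | ~~ isolated_vertex x]|.

(** If the edge density is near 1, apply the previous bound to its square root. Otherwise d ^ s <= d
    already suffices: Bernoulli's inequality keeps [b ^+ s.+1] above 1 - 1 / (4 S ^ 4), the fifth
    power of [S] absorbing the factor s + 1 <= S. *)
Lemma star_moment_le (T : finType) (W : T -> T -> R) (s S : nat) (b : R) :
  (0 < #|T|)%N -> (forall x y, 0 <= W x y <= 1) ->
  (forall x y, W x y = W y x) -> (0 < s < S)%N -> 0 <= b <= 1 ->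
  1 - (4 * S%:R ^+ 5)^-1 < b ^+ 2 -> avg (wdeg W) <= b ^+ 2 ->
  avg (fun x => wdeg W x ^+ s) <= b ^+ s.+1.
Proof.
move=> T0 W01 W_sym /andP[s0 sS] /andP[b0 b1] bS db.
have d01 := wdeg01 T0 W01.
have d0 : 0 <= avg (wdeg W) by apply: avg_ge0 => x; case/andP: (d01 x).
case: (lerP (1 - (4 * S%:R ^+ 4)^-1) (avg (wdeg W))) => [near_clique|far].
  apply: (@le_trans _ _ (Num.sqrt (avg (wdeg W)) ^+ s.+1)).
    apply: (star_moment_le_near_clique T0 W01 W_sym s0 (ltnW sS)) => //.
    by rewrite sqr_sqrtr.
  rewrite lerXn2r ?nnegrE ?sqrtr_ge0//.
  by rewrite -[leRHS](ger0_norm b0) -sqrtr_sqr ler_wsqrtr.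
apply: (@le_trans _ _ (avg (wdeg W))).
  apply: le_avg => x; have /andP[x0 x1] := d01 x.
  by rewrite -[leRHS]expr1 ler_wiXn2l.
apply: (le_trans (ltW far)).
have S0 : (0 : R) < S%:R by rewrite ltr0n; exact: leq_trans sS.
have b2 : b ^+ 2 <= 1 by rewrite exprn_ile1.
apply: (@le_trans _ _ ((b ^+ 2) ^+ s.+1)); last first.
  by rewrite lerXn2r ?nnegrE ?sqr_ge0// expr2 ler_piMr.
have /bernoulli_le-/(_ s.+1) : 0 <= 1 - b ^+ 2 <= 1.
  by rewrite subr_ge0 b2 gerBl sqr_ge0.
rewrite subKr; apply: le_trans; rewrite lerB//.
apply: (@le_trans _ _ (S%:R * (1 - b ^+ 2))).
  by rewrite ler_wpM2r ?subr_ge0// ler_nat.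
apply: (@le_trans _ _ (S%:R * (4 * S%:R ^+ 5)^-1)).
  by rewrite ler_wpM2l ?ltW//; lra.
by rewrite exprSr mulrA invfM mulrCA divff ?mulr1// gt_eqF.
Qed.

Lemma avg_wdeg_le_K2 (G : sgraph) :
  avg (wdeg (@adjr R G)) <= hom_density R K2 G.
Proof.
have -> : avg (wdeg (@adjr R G)) =
    #|[pred u : G * G | adj u.1 u.2]|%:R / #|G|%:R ^+ 2.
  rewrite /avg /wdeg /avg -mulr_suml -mulrA expr2 invfM; congr (_ * _).
  rewrite pair_bigA/= -sum1_card natr_sum [RHS]big_mkcond/=.
  by apply: eq_bigr => u _; rewrite inE /adjr; case: adj.
rewrite /hom_density card_ord ler_wpM2r ?invr_ge0 ?exprn_ge0// ler_nat.
pose f (u : G * G) : {ffun K2 -> G} :=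
  [ffun i : 'I_2 => if i == ord0 then u.1 else u.2].
have f_inj : injective f.
  move=> [u1 u2] [v1 v2] /ffunP uv.
  by have := uv ord0; have := uv ord_max; rewrite !ffunE /= => -> ->.
rewrite -(card_imset _ f_inj) /Defs.hom; apply: subset_leq_card.
apply/fintype.subsetP => g /imsetP[u au ->]; rewrite inE.
move: au; rewrite inE => au.
apply/forallP => x; apply/forallP => y; apply/implyP; rewrite !ffunE.
case: x y => [[|[|//]] xi] [[|[|//]] yi] //= _.
by rewrite adj_sym.
Qed.

(** A star with l > 0 leaves has l + 1 vertices, and by the covering hypothesis no non-isolated
    vertex lies in a star without leaves. *)
Lemma degree_support_le (H : sgraph) (p : {ffun H -> H}) :
  (forall x, ~~ isolated_vertex x -> nontrivial_star p x) ->
  (degree_support H <=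
     \sum_(c : H) (if leaves p c == 0%N then 0 else (leaves p c).+1))%N.
Proof.
move=> cov; rewrite /degree_support -sum1_card (partition_big p predT)//=.
apply: leq_sum => c _; case: (eqVneq (leaves p c) 0%N) => [lc0|_].
  rewrite big1// => x /andP[xiso /eqP xc]; exfalso.
  have /existsP[y yx] := cov x xiso.
  by move/card0_eq: lc0 => /(_ y); rewrite inE -xc yx.
rewrite sum1_card.
apply: leq_trans (_ : #|[predU1 c & [pred x | (p x != x) && (p x == c)]]| <= _)%N.
  apply/subset_leq_card/fintype.subsetP => x.
  rewrite !inE => /andP[_ /eqP pxc]; rewrite pxc eqxx andbT eq_sym.
  by case: eqVneq.
by rewrite cardU1 -add1n leq_add2r; case: (_ \notin _).
Qed.

(** A star with l > 0 leaves contributes at most b ^ (l + 1), where b = sqrt c <= 1, and these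
    exponents add up to at least [degree_support H]. *)
Lemma hom_density_le (H G : sgraph) (c : R) : (0 < #|G|)%N -> 0 <= c <= 1 ->
  1 - (4 * (#|H|.+1)%:R ^+ 5)^-1 < c -> hom_density R K2 G <= c ->
  hom_density R H G <= Num.sqrt c ^+ degree_support H.
Proof.
move=> G0 /andP[c0 c1] Hc Gc.
have [p sp cov] := star_forest H.
rewrite (le_trans (hom_density_le_stars R G0 sp))//.
have b01 : 0 <= Num.sqrt c <= 1 by rewrite sqrtr_ge0 -sqrtr1 ler_wsqrtr.
have [b0 b1] := andP b01.
apply: le_trans (ler_wiXn2l b0 b1 (degree_support_le cov)).
rewrite -prodrXr; apply: ler_prod => v _.
have W01 (x y : G) : 0 <= adjr R x y <= 1 by rewrite /adjr ler0n lern1 leq_b1.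
have d01 := wdeg01 G0 W01.
apply/andP; split.
  by apply: avg_ge0 => x; rewrite exprn_ge0//; case/andP: (d01 x).
case: (eqVneq (leaves p v) 0%N) => [->|l0].
  by rewrite expr0 -[leRHS](avg_cst _ G0); apply: le_avg => x; rewrite expr0.
apply: (star_moment_le (S := #|H|.+1)) => //.
- by move=> x y; rewrite /adjr adj_sym.
- by rewrite lt0n l0 ltnS max_card.
- by rewrite sqr_sqrtr.
- by rewrite sqr_sqrtr// (le_trans (avg_wdeg_le_K2 G)).
Qed.

End UpperBound.

(** * Densities in quasi-cliques *)

Section CliqueGraph.
Variables (T : finType) (K : {set T}).

Definition clique_adj : rel T := fun x y => [&& x != y, x \in K & y \in K].

Lemma clique_adj_sym : symmetric clique_adj.
Proof. by move=> x y; rewrite /clique_adj eq_sym andbA andbAC -andbA. Qed.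

Lemma clique_adj_irr : irreflexive clique_adj.
Proof. by move=> x; rewrite /clique_adj eqxx. Qed.

Definition clique_graph : sgraph := SGraph clique_adj_sym clique_adj_irr.

Lemma quasi_clique_graph : quasi_clique clique_graph.
Proof. by exists K. Qed.

Lemma hom_K2_clique_graph : (Defs.hom K2 clique_graph <= #|K| ^ 2)%N.
Proof.
rewrite /Defs.hom -[2%N]card_ord -card_ffun_on; apply: subset_leq_card.
apply/fintype.subsetP => f; rewrite inE => /forallP fh.
apply/ffun_onP => i.
have [j ij] : exists j : 'I_2, i != j.
  by exists (if i == ord0 then ord_max else ord0); case: (eqVneq i ord0) => // ->.
by have /forallP/(_ j) := fh i; rewrite /= /K2_adj ij /= => /and3P[].
Qed.

(** Overwriting the value at [x] of a map with [f x = f y] loses nothing, since it can be read off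
    at [y]. *)
Lemma card_collision (I : finType) (x y : I) : x != y ->
  (#|T| * #|[pred f : {ffun I -> T} | f x == f y]| <= #|T| ^ #|I|)%N.
Proof.
move=> xy; rewrite -card_ffun -cardX.
pose F (u : T * {ffun I -> T}) := [ffun z => if z == x then u.1 else u.2 z].
rewrite -(card_in_imset (f := F)) ?max_card// => -[v f] [w g].
rewrite !inE /= => /eqP fxy /eqP gxy /ffunP fg.
have vw : v = w by have := fg x; rewrite !ffunE /= eqxx.
have fgE z : z != x -> f z = g z.
  by move=> /negbTE zx; have := fg z; rewrite !ffunE /= zx.
congr (_, _) => //; apply/ffunP => z; case: (eqVneq z x) => [->|/fgE//].
by rewrite fxy gxy fgE// eq_sym.
Qed.

(** An injective map sending all non-isolated vertices into [K] is a homomorphism; a union bound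
    over pairs controls the non-injective maps. *)
Lemma hom_density_clique_ge (R : realType) (H : sgraph) : (0 < #|T|)%N ->
  (#|K|%:R / #|T|%:R) ^+ degree_support H - (#|H| ^ 2)%:R / #|T|%:R
  <= hom_density R H clique_graph.
Proof.
move=> T0; pose n : R := #|T|%:R.
have n0 : n != 0 by rewrite pnatr_eq0 -lt0n.
have n_gt0 : 0 < n by rewrite ltr0n.
pose in_clique (f : {ffun H -> T}) :=
  \prod_(x | ~~ isolated_vertex x) (f x \in K)%:R : R.
have in_cliqueE : (\sum_f in_clique f) / n ^+ #|H| =
    (#|K|%:R / n) ^+ degree_support H.
  rewrite /degree_support -[RHS]prodr_const [RHS]big_mkcond /= -prodr_const.
  rewrite (eq_bigr (fun f : {ffun H -> T} => \prod_x
     (if ~~ isolated_vertex x then (f x \in K)%:R else 1))); last first.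
    by move=> f _; rewrite /in_clique big_mkcond.
  rewrite -(bigA_distr_bigA (fun x v => if ~~ isolated_vertex x then (v \in K)%:R else 1)).
  rewrite -prodf_div; apply: eq_bigr => x _; rewrite inE; case: ifP => _.
    by rewrite -natr_sum -sum1_card [in RHS]big_mkcond.
  by rewrite -[LHS]/((\sum_(v : T) 1) / n) sumr_const divff.
have collE x y : x != y ->
    (\sum_(f : {ffun H -> T}) (f x == f y)%:R) / n ^+ #|H| <= n^-1.
  move=> xy; rewrite ler_pdivrMr ?exprn_gt0// mulrC ler_pdivlMr// mulrC.
  suff <- : #|[pred f : {ffun H -> T} | f x == f y]|%:R =
      \sum_(f : {ffun H -> T}) (f x == f y)%:R :> R.
    by have := card_collision xy; rewrite -(ler_nat R) natrM natrX.
  rewrite -sum1_card natr_sum big_mkcond /=; apply: eq_bigr => f _.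
  by rewrite inE; case: (f x == f y).
(* A non-injective map is counted at least once among the collisions. *)
have cover f : in_clique f <= (@is_hom H clique_graph f)%:R +
    \sum_(x : H) \sum_(y | x != y) (f x == f y)%:R.
  have coll0 x : 0 <= \sum_(y | x != y) (f x == f y)%:R :> R.
    by apply: sumr_ge0 => y _; exact: ler0n.
  case: (boolP (injectiveb f)) => [/injectiveP finj|/injectivePn[x [y xy fxy]]].
    apply: (@le_trans _ _ (@is_hom H clique_graph f)%:R); last first.
      by rewrite lerDl sumr_ge0.
    case: (boolP [forall x, ~~ isolated_vertex x ==> (f x \in K)]); last first.
      rewrite negb_forall => /existsP[x]; rewrite negb_imply => /andP[xi xK].
      by rewrite /in_clique (bigD1 x)//= (negbTE xK) mul0r ler0n.
    move=> /forallP fK.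
    have adjK x y : adj x y -> f x \in K.
      move=> xy; apply: (implyP (fK x)); rewrite negb_forall.
      by apply/existsP; exists y; rewrite negbK.
    have -> : @is_hom H clique_graph f.
      apply/forallP => x; apply/forallP => y; apply/implyP => xy.
      rewrite /= /clique_adj (adjK _ _ xy) (adjK y x) 1?adj_sym// !andbT.
      by apply: contraTneq xy => /finj->; rewrite adj_irr.
    by rewrite /in_clique prodr_ile1// => x _; rewrite ler0n lern1 leq_b1.
  apply: (@le_trans _ _ 1).
    by rewrite /in_clique prodr_ile1// => x' _; rewrite ler0n lern1 leq_b1.
  rewrite (bigD1 x)//= (bigD1 y)//= fxy eqxx.
  rewrite addrCA -[leLHS]addr0 -addrA lerD2l !addr_ge0 ?ler0n ?sumr_ge0//.
rewrite -/n lerBlDr -in_cliqueE /hom_density natr_hom.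
apply: (@le_trans _ _ ((\sum_(f : {ffun H -> T}) ((@is_hom H clique_graph f)%:R +
    \sum_(x : H) \sum_(y | x != y) (f x == f y)%:R)) / n ^+ #|H|)).
  by rewrite ler_wpM2r ?invr_ge0 ?exprn_ge0// ler_sum.
rewrite big_split mulrDl lerD2l exchange_big /= mulr_suml.
have collx x : (\sum_(f : {ffun H -> T}) \sum_(y | x != y) (f x == f y)%:R)
    / n ^+ #|H| <= #|H|%:R / n.
  rewrite exchange_big mulr_suml (le_trans (ler_sum _ (collE x)))//.
  rewrite sumr_const -[leLHS]mulr_natl ler_wpM2r ?invr_ge0 ?(ltW n_gt0)//.
  by rewrite ler_nat max_card.
rewrite (le_trans (ler_sum _ (fun x _ => collx x)))// sumr_const.
by rewrite -[leLHS]mulr_natl natrX expr2 mulrA.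
Qed.

End CliqueGraph.

(** * Lower bound and equality of the limits *)

Lemma quasi_clique_density_ge (R : realType) (H : sgraph) (c e : R) (n : nat) :
  0 <= c <= 1 -> 0 < e -> exists G : sgraph,
  [/\ density_le c G, quasi_clique G, (n <= #|G|)%N &
      Num.sqrt c ^+ degree_support H - e <= hom_density R H G].
Proof.
move=> /andP[c0 c1] e0.
set b := Num.sqrt c; set m := degree_support H.
have b0 : 0 <= b by rewrite sqrtr_ge0.
have b1 : b <= 1 by rewrite -sqrtr1 ler_wsqrtr.
(* The loss is at most C / N: m / N from rounding the clique size and [#|H| ^ 2] / N from
   collisions. *)
pose C : R := m%:R + (#|H| ^ 2)%:R.
pose N := (maxn n (Num.truncn (C / e)).+1).
have NC : C / e <= N%:R.
  have := truncn_itv (x := C / e); rewrite divr_ge0 ?(ltW e0) ?addr_ge0//.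
  move=> /(_ isT)/andP[_ /ltW/le_trans]; apply.
  by rewrite ler_nat leq_max leqnn orbT.
have N0 : (0 < N)%N by rewrite leq_max orbT.
have n_gt0 : 0 < N%:R :> R by rewrite ltr0n.
(* Rounding down keeps the edge density at most c. *)
pose k := Num.truncn (b * N%:R).
have bN0 : 0 <= b * N%:R by rewrite mulr_ge0.
have /andP[kbN bNk] := truncn_itv bN0; rewrite -/k in kbN bNk.
have kb : k%:R / N%:R <= b by rewrite ler_pdivrMr.
have kb' : b - k%:R / N%:R <= N%:R^-1.
  by rewrite lerBlDr -[X in X + _]mul1r -mulrDl ler_pdivlMr// addrC natr1 ltW.
have kN : (k <= N)%N.
  by rewrite -(ler_nat R) (le_trans kbN)// ler_piMl.
pose K : {set 'I_N} := [set i : 'I_N | (i < k)%N]%SET.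
have cK : #|K| = k.
  rewrite -sum1_card (eq_bigl (fun i : 'I_N => (i < k)%N)) => [|i]; last by rewrite inE.
  by rewrite -(big_ord_widen _ (fun=> 1%N) kN) sum1_card card_ord.
exists (clique_graph K); split.
- rewrite /density_le /hom_density !card_ord ler_pdivrMr ?exprn_gt0//.
  have := hom_K2_clique_graph K; rewrite cK -(ler_nat R) natrX.
  move=> /le_trans; apply.
  have cE : c = b ^+ 2 by rewrite sqr_sqrtr.
  by rewrite cE -exprMn lerXn2r ?nnegrE.
- exact: quasi_clique_graph.
- by rewrite card_ord leq_max leqnn.
have := hom_density_clique_ge K R H; rewrite card_ord cK => /(_ N0).
apply: le_trans; rewrite -/m.
have k0 : 0 <= k%:R / N%:R :> R by rewrite divr_ge0.
have := ler_sub_exprn m (introT andP (conj k0 kb)) b1.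
have : m%:R * (b - k%:R / N%:R) <= m%:R * N%:R^-1 by rewrite ler_wpM2l.
have : C / N%:R <= e by rewrite ler_pdivrMr// mulrC -ler_pdivrMr.
rewrite /C mulrDl; lra.
Qed.

Theorem theorem4p1 (R : realType) (H : sgraph) :
  exists k : R, [/\ 0 <= k, k < 1 &
    forall c : R, 0 <= c -> c <= 1 -> k < c ->
      max_density H c =
      graph_limsup (graph_classI (density_le c) quasi_clique) (hom_density R H)].
Proof.
(* The threshold comes from [star_moment_le] with S = |H| + 1, larger than any number of leaves. *)
exists (1 - (4 * (#|H|.+1)%:R ^+ 5)^-1); split.
- rewrite subr_ge0 invf_le1; last by rewrite mulr_gt0// exprn_gt0.
  have : 1 <= (#|H|.+1)%:R ^+ 5 :> R by rewrite exprn_ege1// ler1n.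
  lra.
- by rewrite gtrBl invr_gt0 mulr_gt0// exprn_gt0.
move=> c c0 c1 Hc; have c01 : 0 <= c <= 1 by rewrite c0.
rewrite /max_density.
(* Both classes lie between the quasi-cliques of density at most c and all graphs of density at most
   c, so one computation serves for both. *)
suff limE (C : graph_class) : (forall G, C G -> density_le c G) ->
    (forall G, density_le c G -> quasi_clique G -> C G) ->
    graph_limsup C (hom_density R H) = (Num.sqrt c ^+ degree_support H)%:E.
  rewrite !limE//; by [move=> G []|].
(* The supremum already equals the limit for every n > 0, where the graphs are nonempty. *)
move=> Cc qC; apply: lim_near_cst => //.
near=> n; apply/eqP; rewrite eq_le; apply/andP; split.
  apply: ge_ereal_sup => _ [G [CG nG ->]]; rewrite lee_fin.
  apply: hom_density_le => //; last exact: Cc.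
  by apply: leq_trans nG; near: n; exact: nbhs_infty_gt.
apply/lee_subgt0Pr => e e0.
have [G [Gc Gq Gn Ge]] := quasi_clique_density_ge H n c01 e0.
apply: (@le_trans _ _ (hom_density R H G)%:E); first by rewrite -EFinB lee_fin.
by apply: ereal_sup_ubound; exists G; split => //; exact: qC.
Unshelve. all: end_near.
Qed.
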